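(* Let $p$ be an odd prime for which $2$ is a primitive root. Then the exact exponent $\alpha=\alpha(p)$ in the remainder term of the formula $T^{(j)}_{p,a}(x)=\frac{x}{2p}+O(x^{\lambda})$, where $\lambda=\frac{\ln 3}{\ln 4}$, $a\in\{0,1,\ldots,p-1\}$ and $j\in\{0,1\}$, is $$\alpha=\frac{\ln p}{(p-1)\ln 2}.$$
   Context: For a nonnegative integer $n$, $s(n)$ denotes the number of $1$'s in the binary expansion of $n$. For an integer $m>1$, an integer $a\in[0,m-1]$ and $j\in\{0,1\}$, put $$T^{(j)}_{m,a}(x)=\#\{n\in\mathbb{Z}: 0\le n<x,\ n\equiv a \pmod m,\ s(n)\equiv j \pmod 2\}.$$ The exact exponent in the remainder term is the number $\alpha=\alpha(m)$ such that for every $\varepsilon>0$, as $x\to\infty$, $$T^{(j)}_{m,a}(x)=\frac{x}{2m}+O(x^{\alpha+\varepsilon})\quad\text{and}\quad T^{(j)}_{m,a}(x)=\frac{x}{2m}+\Omega(x^{\alpha-\varepsilon}),$$ for $a\in\{0,\ldots,m-1\}$ and $j\in\{0,1\}$ (the same $\alpha$, depending only on $m$, serves for all such $a$ and $j$). Here $f(x)=\Omega(g(x))$ with $g>0$ has the usual analytic number theory meaning that $f(x)\ne o(g(x))$, i.e. $\limsup_{x\to\infty}|f(x)|/g(x)>0$. *)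

(* Defs.v *)
From HB Require Import structures.
From mathcomp Require Import all_boot all_order all_algebra.
From mathcomp Require Import finmap.
From mathcomp Require Import all_classical all_reals all_analysis.
Set Implicit Arguments.
Unset Strict Implicit.
Unset Printing Implicit Defensive.
Import Order.TTheory GRing.Theory Num.Theory.
Import numFieldNormedType.Exports.
Local Open Scope classical_set_scope.
Local Open Scope ring_scope.

(* The number of 1's in the binary expansion of [n]. The digit of weight
   [2 ^ i] is the parity of [n %/ 2 ^ i]; as [n < 2 ^ n], it is 0 for
   [i >= n]. *)
Definition binary_ones (n : nat) : nat := (\sum_(i < n) odd (n %/ 2 ^ i))%N.

(* T^{(j)}_{m,a}(x). The integers [0 <= n < x] are taken in [nat]; the set is
   finite, so [fset_set] does not take its default value. *)
Definition residue_parity_count (R : realType) (m : nat) (a : 'I_m)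
    (j : 'I_2) (x : R) : nat :=
  #|` fset_set [set n : nat | [/\ n%:R < x, n = a %[mod m]
                                & binary_ones n = j %[mod 2]]] |.

Definition count_error (R : realType) (m : nat) (a : 'I_m) (j : 'I_2)
    (x : R) : R^o :=
  (residue_parity_count a j x)%:R - x / (2 * m%:R).

Canonical pinfty_filter_on (R : realType) : filter_on R :=
  FilterType (pinfty_nbhs R) _.

Definition bigO_at_infty (R : realType) (f g : R -> R^o) : Prop :=
  f =O_ (pinfty_nbhs R) g.

(* Omega in the sense of analytic number theory (Hardy-Littlewood):
   [f] is not o([g]). This is weaker than the ['Omega_F] of the library, which
   bounds [`|f|] from below at all points near [F]. *)
Definition not_littleo_at_infty (R : realType) (f g : R -> R^o) : Prop :=
  ~ (f =o_ (pinfty_nbhs R) g).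

Definition exact_exponent (R : realType) (m : nat) (alpha : R) : Prop :=
  forall eps : R, 0 < eps -> forall (a : 'I_m) (j : 'I_2),
    bigO_at_infty (count_error a j) (fun x : R => x `^ (alpha + eps))
    /\ not_littleo_at_infty (count_error a j)
         (fun x : R => x `^ (alpha - eps)).

(* For [p] prime: 2 has multiplicative order [p - 1] modulo [p]. *)
Definition two_is_primitive_root (p : nat) : Prop :=
  p.-1.-primitive_root (2%:R : 'F_p).

(* Main.v *)
Require Import Defs.
From HB Require Import structures.
From mathcomp Require Import all_boot all_order all_algebra.
From mathcomp Require Import finmap.
From mathcomp Require Import all_classical all_reals all_analysis.
From mathcomp Require Import algC cyclotomic zify ring lra.
Set Implicit Arguments.
Unset Strict Implicit.
Unset Printing Implicit Defensive.
Import Order.TTheory GRing.Theory Num.Theory.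
Import numFieldNormedType.Exports.
Local Open Scope classical_set_scope.
Local Open Scope ring_scope.

(** Let [eps n = (-1) ^ s(n)] be the Thue-Morse sign and
    [D_a N] the sum of [eps n] over [n < N], [n = a] modulo [p]. Up to a bounded
    quantity the error term is [D_a / 2] or [- D_a / 2]
    ([count_error_residue_sum]), so everything is about the growth of [D_a].

    Put [b = 2 ^ (p - 1)]. The generating polynomial of the first [b] signs is
    [\prod_(i < p - 1) (1 - X ^ (2 ^ i))]. As 2 is a primitive root, the
    exponents [2 ^ i] run over all nonzero residues modulo [p], so that at a
    primitive [p]-th root of unity this polynomial takes the value
    [\prod_(0 < c < p) (1 - z ^ c) = p], while at 1 it vanishes. Hence it is
    [p - (1 + X + ... + X ^ (p - 1))] modulo [X ^ p - 1], which is [block_sum].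
    Since [b = 1] modulo [p] and [eps (b * m + t) = eps m * eps t] for [t < b],
    summing over blocks of length [b] gives
    [D_a (b * N) = p * D_a N - (eps 0 + ... + eps (N - 1))]
    ([residue_sum_block]), where the subtracted sum is bounded, and is 0 for
    even [N].

    Thus multiplying [N] by [b] multiplies [D_a] by [p], up to a bounded error:
    by induction on the number of base [b] digits, [D_a N = O(N ^ alpha)], where
    [b ^ alpha = p]; and [D_a (b ^ q)] has absolute value at least
    [p ^ (q - 1) = (b ^ q) ^ alpha / p]. So the error term is [O(x ^ alpha)] and
    not [o(x ^ alpha)], without any epsilon. This determines the exact exponent
    ([exact_exponent_unique]), and the bound with exponent [ln 3 / ln 4] follows
    from [alpha <= ln 3 / ln 4], that is from [p ^ 2 <= 3 ^ (p - 1)]. *)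

(** * The Thue-Morse sign *)

(** The number of digits read off does not matter once all of them are covered;
    this frees the recursions on [n] from the bound [i < n] of the definition. *)
Lemma binary_onesE (K n : nat) : (n <= K)%N ->
  binary_ones n = (\sum_(i < K) odd (n %/ 2 ^ i))%N.
Proof.
move=> nK; rewrite -(subnKC nK) /binary_ones big_split_ord /=.
rewrite [X in (_ + X)%N]big1 ?addn0// => i _.
by rewrite divn_small // (leq_trans (ltn_expl n (isT : (1 < 2)%N))) // leq_exp2l // leq_addr.
Qed.

Lemma binary_ones_double (n r : nat) : (r < 2)%N ->
  binary_ones (2 * n + r) = (r + binary_ones n)%N.
Proof.
move=> r2; rewrite (@binary_onesE (2 * n + r).+1) // big_ord_recl expn0 divn1.
rewrite (@binary_onesE (2 * n + r) n); last by lia.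
congr (_ + _)%N; first by case: r r2 => [|[|]] // _; rewrite oddD oddM.
apply: eq_bigr => i _; rewrite lift0 expnS divnMA.
by congr (odd (_ %/ _)); rewrite mulnC divnMDl // (divn_small r2) addn0.
Qed.

Definition thue_morse (n : nat) : int := (-1) ^+ binary_ones n.

Lemma normr_thue_morse (n : nat) : `|thue_morse n| = 1.
Proof. by rewrite /thue_morse normrX normrN1 expr1n. Qed.

Lemma thue_morse0 : thue_morse 0 = 1.
Proof. by rewrite /thue_morse /binary_ones big_ord0. Qed.

Lemma thue_morse_double (n r : nat) : (r < 2)%N ->
  thue_morse (2 * n + r) = (-1) ^+ r * thue_morse n.
Proof. by move=> r2; rewrite /thue_morse binary_ones_double // exprD. Qed.

(** Writing [t] with [k] binary digits after those of [m] adds the digit sums. *)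
Lemma thue_morse_concat (k m t : nat) : (t < 2 ^ k)%N ->
  thue_morse (2 ^ k * m + t) = thue_morse m * thue_morse t.
Proof.
elim: k t => [|k IHk] t; first by case: t => // _; rewrite thue_morse0 mulr1 mul1n addn0.
rewrite expnS => tk; have r2 : (t %% 2 < 2)%N by rewrite ltn_mod.
have q2 : (t %/ 2 < 2 ^ k)%N by rewrite ltn_divLR // mulnC.
rewrite {1 2}(divn_eq t 2) (mulnC _ 2) addnA -mulnA -mulnDr.
by rewrite !thue_morse_double // IHk // mulrCA.
Qed.

(** Expanding the product, the subset of factors that contribute
    [- z ^ (2 ^ i)] is the set of binary digits 1 of [t]. *)
Lemma sum_thue_morse_expr (A : comNzRingType) (z : A) (k : nat) :
  \sum_(t < 2 ^ k) (thue_morse t)%:~R * z ^+ t = \prod_(i < k) (1 - z ^+ (2 ^ i)).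
Proof.
elim: k => [|k IHk].
  by rewrite big_ord_recl !big_ord0 /= thue_morse0 expr0 mulr1 addr0.
rewrite big_ord_recr /= -IHk expnSr muln2 -addnn big_split_ord /=.
rewrite mulrBr mulr1 mulr_suml -sumrN; congr (_ + _); apply: eq_bigr => t _.
have tm1 : thue_morse 1 = -1.
  by have /= := thue_morse_double 0 (isT : (1 < 2)%N); rewrite thue_morse0.
have := thue_morse_concat 1 (ltn_ord t); rewrite muln1 => ->.
by rewrite tm1 mulN1r rmorphN mulNr exprD -mulrA (mulrC (z ^+ t)).
Qed.

Definition sum_thue_morse (N : nat) : int := \sum_(n < N) thue_morse n.

(** The signs at [2 * n] and [2 * n + 1] are opposite, so they cancel in pairs. *)
Lemma sum_thue_morse_even (N : nat) : sum_thue_morse (2 * N) = 0.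
Proof.
rewrite /sum_thue_morse; elim: N => [|N IHN]; first by rewrite muln0 big_ord0.
rewrite mulnS addnC addn2 !big_ord_recr /= IHN -(addn1 (2 * N)).
have := @thue_morse_double N 0 isT; rewrite addn0 => ->.
by rewrite thue_morse_double // expr0 expr1 mul1r mulN1r add0r subrr.
Qed.

Lemma normr_sum_thue_morse (N : nat) : `|sum_thue_morse N| <= 1.
Proof.
rewrite (divn_eq N 2) mulnC; case: (N %% 2)%N (ltn_mod N 2) => [|[|]] // _.
  by rewrite addn0 sum_thue_morse_even normr0.
by rewrite addn1 /sum_thue_morse big_ord_recr /= -/(sum_thue_morse _)
  sum_thue_morse_even add0r normr_thue_morse.
Qed.

(** * Sums of signs over a residue class *)

Definition residue_sum (m a N : nat) : int :=
  \sum_(n < N) thue_morse n * (n == a %[mod m])%:R.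

Lemma residue_sumD (m a N K : nat) : residue_sum m a (N + K) =
  residue_sum m a N + \sum_(t < K) thue_morse (N + t) * (N + t == a %[mod m])%:R.
Proof. by rewrite /residue_sum big_split_ord. Qed.

Lemma residue_sum_lipschitz (m a N K : nat) :
  `|residue_sum m a (N + K) - residue_sum m a N| <= K%:R.
Proof.
rewrite residue_sumD addrC addKr; apply: le_trans (ler_norm_sum _ _ _) _.
rewrite -[K in K%:R]card_ord -sumr_const; apply: ler_sum => t _.
by case: (_ == _); rewrite ?mulr1 ?mulr0 ?normr0 ?normr_thue_morse.
Qed.

Lemma normr_residue_sum (m a N : nat) : `|residue_sum m a N| <= N%:R.
Proof.
have := residue_sum_lipschitz m a 0 N.
by rewrite add0n {2}/residue_sum big_ord0 subr0.
Qed.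

(** * The sum of signs over a block *)

Section PrimitiveTwo.
Variable (p : nat).
Hypotheses (p_prime : prime p) (p_odd : odd p) (two_prim : two_is_primitive_root p).

(** The [z ^ (2 ^ i)], [i < p - 1], are pairwise distinct because 2 is a primitive
    root. They differ from 1 because [p] is odd, hence they are roots of
    [1 + X + ... + X ^ (p - 1)]; so they are all its roots, and the product is the
    value of this polynomial at 1. *)
Lemma prod_one_sub_expr_two (z : algC) : p.-primitive_root z ->
  \prod_(i < p.-1) (1 - z ^+ (2 ^ i)) = p%:R.
Proof.
move=> z_prim.
have p_gt0 := prime_gt0 p_prime.
pose S : {poly algC} := \poly_(i < p) 1.
have szS : size S = p by rewrite size_poly_eq // oner_eq0.
pose rs := [seq z ^+ (2 ^ i) | i <- iota 0 p.-1].
have rootS : all (root S) rs.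
  apply/allP => _ /mapP[i _ ->]; set y := z ^+ _.
  have y1 : y - 1 != 0.
    rewrite subr_eq0 -[1](expr0 z) (eq_prim_root_expr z_prim) mod0n.
    rewrite -/(dvdn _ _) Euclid_dvdX // negb_and; apply/orP; left.
    by rewrite (dvdn_prime2 p_prime (isT : prime 2)); apply: contraTneq p_odd => ->.
  rewrite /root horner_poly (eq_bigr (fun j : 'I_p => y ^+ j)); last first.
    by move=> j _; rewrite mul1r.
  apply/eqP/(mulfI y1); rewrite -subrX1 mulr0 /y exprAC (prim_expr_order z_prim).
  by rewrite expr1n subrr.
have rs_uniq : uniq rs.
  rewrite map_inj_in_uniq ?iota_uniq // => i j.
  rewrite !mem_iota !add0n => /andP[_ ip] /andP[_ jp] /eqP.
  rewrite (eq_prim_root_expr z_prim) => /eqP eq2.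
  have : (2%:R : 'F_p) ^+ i == 2%:R ^+ j.
    rewrite -!natrX -(Fp_nat_mod p_prime) eq2 (Fp_nat_mod p_prime) eqxx //.
  by rewrite (eq_prim_root_expr two_prim) !modn_small // => /eqP.
have SE : S = \prod_(y <- rs) ('X - y%:P).
  rewrite [LHS](@all_roots_prod_XsubC _ S rs) ?uniq_rootsE //.
    by rewrite /lead_coef szS coef_poly prednK // leqnn scale1r.
  by rewrite szS size_map size_iota prednK.
have <- : S.[1] = p%:R.
  rewrite horner_poly; under eq_bigr => i _ do rewrite mul1r expr1n.
  by rewrite sumr_const card_ord.
rewrite SE horner_prod /rs big_map.
have -> : iota 0 p.-1 = index_iota 0 p.-1 by rewrite /index_iota subn0.
rewrite big_mkord.
by apply: eq_bigr => i _; rewrite hornerXsubC.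
Qed.

(** Both sides have the same discrete Fourier transform in [a]: with
    [G = \sum_c (left - right) X ^ c], the value [G.[y]] at a [p]-th root of unity
    [y] is [y ^ N * (\prod_i (1 - y ^ (2 ^ i)) - p) + \sum_c y ^ c], which vanishes
    both for [y = 1] and for [y] primitive. Having degree less than [p] and [p]
    roots, [G] is 0. The shift [N] keeps the statement ready for blocks that start
    in any residue class. *)
Lemma block_sum (N a : nat) :
  \sum_(t < 2 ^ p.-1) thue_morse t * (N + t == a %[mod p])%:R
    = p%:R * (N == a %[mod p])%:R - 1.
Proof.
have p_gt0 := prime_gt0 p_prime.
have p_gt1 := prime_gt1 p_prime.
have [z z_prim] := C_prim_root_exists p_gt0.
pose g (c : nat) : int := \sum_(t < 2 ^ p.-1) thue_morse t * (N + t == c %[mod p])%:R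
    - p%:R * (N == c %[mod p])%:R + 1.
pose G : {poly algC} := \poly_(c < p) (g c)%:~R.
have select n (y : algC) : y ^+ p = 1 ->
    \sum_(c < p) (n == c %[mod p])%:R * y ^+ c = y ^+ n.
  move=> yp; have np : (n %% p < p)%N by rewrite ltn_mod.
  rewrite (bigD1 (Ordinal np)) //= modn_mod eqxx mul1r big1 ?addr0 ?expr_mod //.
  move=> c /eqP nc; rewrite (modn_small (ltn_ord c)).
  by case: eqP => [e|]; rewrite ?mul0r //; case: nc; apply: val_inj; rewrite /= e.
have Gy y : y ^+ p = 1 -> G.[y] =
    y ^+ N * (\prod_(i < p.-1) (1 - y ^+ (2 ^ i)) - p%:R) + \sum_(c < p) y ^+ c.
  move=> yp; rewrite horner_poly -sum_thue_morse_expr.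
  under eq_bigr => c _ do rewrite rmorphD rmorphB /= rmorph1 rmorphM /= !rmorph_nat
    rmorph_sum /= mulrDl mulrBl mul1r.
  rewrite big_split sumrB /=; congr (_ + _); rewrite mulrBr; congr (_ - _).
    under eq_bigr => c _ do rewrite mulr_suml.
    rewrite exchange_big mulr_sumr /=; apply: eq_bigr => t _.
    under eq_bigr => c _ do rewrite rmorphM /= rmorph_nat -mulrA.
    by rewrite -mulr_sumr select // exprD mulrCA.
  under eq_bigr => c _ do rewrite -mulrA.
  by rewrite -mulr_sumr select // mulrC.
have G0 : G = 0.
  apply: (@roots_geq_poly_eq0 _ _ [seq z ^+ k | k <- iota 0 p]).
  - apply/allP => x /mapP[k]; rewrite mem_iota add0n /= => kp -> {x}.
    have zkp : (z ^+ k) ^+ p = 1 by rewrite exprAC (prim_expr_order z_prim) expr1n.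
    rewrite /root Gy //; case: k kp zkp => [|k] kp zkp.
      under eq_bigr => i _ do rewrite expr0 expr1n subrr.
      under [X in _ + X]eq_bigr => i _ do rewrite expr0 expr1n.
      rewrite sumr_const card_ord prodr_const card_ord expr0n expr0 expr1n mul1r.
      have /negPf -> : p.-1 != 0%N by lia.
      by rewrite sub0r addNr.
    have zk_prim : p.-primitive_root (z ^+ k.+1).
      rewrite prim_root_exp_coprime // coprime_sym prime_coprime //.
      by rewrite gtnNdvd.
    rewrite (prod_one_sub_expr_two zk_prim) subrr mulr0 add0r.
    have zk1 : z ^+ k.+1 - 1 != 0.
      by rewrite subr_eq0 -[1](expr0 z) (eq_prim_root_expr z_prim) mod0n modn_small.
    by apply/eqP/(mulfI zk1); rewrite -subrX1 mulr0 zkp subrr.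
  - rewrite map_inj_in_uniq ?iota_uniq // => i j.
    rewrite !mem_iota !add0n => /andP[_ ip] /andP[_ jp] /eqP.
    by rewrite (eq_prim_root_expr z_prim) !modn_small // => /eqP.
  - by rewrite size_map size_iota size_poly.
have ap : (a %% p < p)%N by rewrite ltn_mod.
have : G`_(a %% p) = 0 by rewrite G0 coef0.
rewrite coef_poly ap => /eqP; rewrite intr_eq0 /g !modn_mod => /eqP.
by move=> h; apply/eqP; rewrite -subr_eq0 opprB addrA addrAC h.
Qed.

(** Each block of length [2 ^ (p - 1)] contributes one [block_sum], as
    [2 ^ (p - 1) = 1] modulo [p]. *)
Lemma residue_sum_block (a N : nat) :
  residue_sum p a (2 ^ p.-1 * N) = p%:R * residue_sum p a N - sum_thue_morse N.
Proof.
elim: N => [|N IHN].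
  by rewrite muln0 /residue_sum /sum_thue_morse !big_ord0 mulr0 subrr.
have fermat : (2 ^ p.-1 = 1 %[mod p])%N.
  have := prim_expr_order two_prim; rewrite -natrX -[1]/(1%:R).
  by move/(congr1 (@nat_of_ord _)); rewrite !val_Fp_nat.
rewrite mulnS addnC residue_sumD IHN.
under eq_bigr => t _.
  rewrite (thue_morse_concat _ (ltn_ord t)) -modnDml -modnMml fermat modnMml modnDml mul1n.
  rewrite -mulrA; over.
rewrite -mulr_sumr block_sum //.
rewrite /residue_sum /sum_thue_morse !big_ord_recr /=.
ring.
Qed.

Lemma residue_sum_block_rem (a N r : nat) : (r < 2 ^ p.-1)%N ->
  `|residue_sum p a (2 ^ p.-1 * N + r)|
     <= p%:R * `|residue_sum p a N| + (2 ^ p.-1).+1%:R.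
Proof.
move=> rb; have lip := residue_sum_lipschitz p a (2 ^ p.-1 * N) r.
have E1 := normr_sum_thue_morse N.
have rb' : r%:R <= (2 ^ p.-1)%:R :> int by rewrite ler_nat ltnW.
have := ler_normD (residue_sum p a (2 ^ p.-1 * N + r) - residue_sum p a (2 ^ p.-1 * N))
  (residue_sum p a (2 ^ p.-1 * N)).
have := ler_normB (p%:R * residue_sum p a N) (sum_thue_morse N).
rewrite -residue_sum_block subrK (normrM p%:R) ger0_norm // -natr1.
lra.
Qed.

(** The sum of signs subtracted in [residue_sum_block] is 1 for the first block
    ([N = 1]) and 0 afterwards ([N] even), so only the first step differs from a
    multiplication by [p]. *)
Lemma residue_sum_expn (a q : nat) :
  residue_sum p a ((2 ^ p.-1) ^ q.+1)
    = p%:R ^+ q * (p%:R * (a == 0 %[mod p])%:R - 1).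
Proof.
elim: q => [|q IHq].
  rewrite expn1 -[(2 ^ p.-1)%N]muln1 residue_sum_block /residue_sum /sum_thue_morse.
  by rewrite !big_ord_recl !big_ord0 /= thue_morse0 !addr0 mul1r expr0 mul1r eq_sym.
rewrite expnS residue_sum_block IHq exprS mulrA.
have -> : ((2 ^ p.-1) ^ q.+1 = 2 * (2 ^ p.-2 * (2 ^ p.-1) ^ q))%N.
  rewrite mulnA -expnS prednK ?expnS //.
  by case: p p_prime p_odd => [|[|[]]].
by rewrite sum_thue_morse_even subr0.
Qed.

Lemma residue_sum_expn_ge (a q : nat) :
  p%:R ^+ q <= `|residue_sum p a ((2 ^ p.-1) ^ q.+1)|.
Proof.
rewrite residue_sum_expn normrM ger0_norm ?exprn_ge0 // ler_peMr ?exprn_ge0 //.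
have p2 := prime_gt1 p_prime.
case: (_ == _); last by rewrite mulr0 sub0r normrN1.
by rewrite mulr1; lia.
Qed.

End PrimitiveTwo.

(** * The error term in terms of sums of signs *)

(** The shift by [m - a.+1] moves the class of [a] to that of [-1], where the
    quotient by [m] jumps at the next step. *)
Lemma card_residue_class (m N : nat) (a : 'I_m) :
  (\sum_(n < N) (n == a %[mod m]))%N = ((N + (m - a.+1)) %/ m)%N.
Proof.
have am := ltn_ord a; elim: N => [|N IHN].
  by rewrite big_ord0 add0n divn_small //; lia.
rewrite big_ord_recr /= IHN addSn divnS; last by lia.
rewrite addnC; congr (_ + _)%N; congr nat_of_bool.
rewrite -addnS -subSn // subSS -(eqn_modDr (m - a)) subnKC; last by lia.
by rewrite modnn.
Qed.

Lemma residue_parity_countE (R : realType) (m : nat) (a : 'I_m) (j : 'I_2)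
    (x : R) (N : nat) : (N%:R - 1 < x <= N%:R) ->
  residue_parity_count a j x =
  (\sum_(n < N) ((n == a %[mod m]) && (binary_ones n == j %[mod 2])))%N.
Proof.
move=> /andP[Nx xN].
pose P n := (n == a %[mod m]) && (binary_ones n == j %[mod 2]).
have E : [set n : nat | [/\ n%:R < x, n = a %[mod m] & binary_ones n = j %[mod 2]]]
    = [set` [fset n in [seq n <- iota 0 N | P n]]%fset].
  apply/seteqP; split=> n /=; rewrite !inE mem_filter mem_iota /= add0n.
    move=> [nx na nj]; rewrite /P na nj !eqxx /=.
    by rewrite -(ltr_nat R) (lt_le_trans nx).
  move=> /andP[/andP[/eqP na /eqP nj] nN]; split => //.
  by apply: le_lt_trans Nx; rewrite lerBrDr natr1 ler_nat.
rewrite /residue_parity_count E set_fsetK card_fseq undup_id; last first.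
  by rewrite filter_uniq // iota_uniq.
rewrite size_filter -sum1_count big_mkcond /=.
have -> : iota 0 N = index_iota 0 N by rewrite /index_iota subn0.
by rewrite big_mkord; apply: eq_bigr => n _; rewrite -/(P n); case: (P n).
Qed.

(** The indicator of [s(n) = j] modulo 2 is [(1 + (-1) ^ j * eps n) / 2]; what is
    left is the error in counting a residue class and in rounding [x] up to [N]. *)
Lemma count_error_residue_sum (R : realType) (m : nat) (a : 'I_m) (j : 'I_2)
    (x : R) (N : nat) : (N%:R - 1 < x <= N%:R) ->
  `|count_error a j x - (-1) ^+ j * (residue_sum m a N)%:~R / 2| <= 1.
Proof.
move=> xN; rewrite /count_error (residue_parity_countE _ _ xN).
have am := ltn_ord a.
set T := (\sum_(n < N) _)%N.
pose A := (\sum_(n < N) (n == a %[mod m]))%N.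
have TE : (T%:R : int) * 2 = A%:R + (-1) ^+ j * residue_sum m a N.
  rewrite /T /A /residue_sum !natr_sum mulr_suml mulr_sumr -big_split /=.
  apply: eq_bigr => n _; case: (_ == a %% m)%N => /=; rewrite ?mulr0 ?mul0r //.
  rewrite mulr1 /thue_morse -[(-1) ^+ j]signr_odd -[(-1) ^+ binary_ones n]signr_odd !modn2.
  by case: (odd _) (odd _) => [] [].
have {}TE : (T%:R : R) * 2 = A%:R + (-1) ^+ j * (residue_sum m a N)%:~R.
  have /= := congr1 (fun n : int => n%:~R : R) TE.
  rewrite rmorphM /= !rmorph_nat => ->.
  by rewrite intrD intrM rmorph_nat rmorphXn rmorphN1.
have AN : N%:R - m%:R <= (m%:R * A%:R : R) <= N%:R + m%:R.
  have /andP[A1 A2] : (N <= A * m + m)%N && (A * m <= N + m)%N.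
    rewrite /A card_residue_class.
    have := divn_eq (N + (m - a.+1)) m; have := ltn_mod (N + (m - a.+1)) m.
    move: (_ %/ _)%N (_ %% _)%N => Q r; lia.
  move: A1 A2; rewrite -!(ler_nat R) !natrD natrM => A1 A2.
  by apply/andP; split; lra.
have m1 : 1 <= m%:R :> R by rewrite ler1n; lia.
move/andP: xN AN => [x1 x2] /andP[A1 A2].
set D := (-1) ^+ j * _ in TE *.
have -> : T%:R - x / (2 * m%:R) - D / 2 = (m%:R * A%:R - x) / (2 * m%:R).
  have -> : T%:R = (A%:R + D) / 2 :> R by rewrite -TE; field.
  by field; lra.
by rewrite ler_norml ler_pdivrMr ?ler_pdivlMr; lra.
Qed.

(** * Powers as gauge functions *)

Section Asymptotics.
Variable R : realType.
Implicit Types (f : R -> R^o) (u v : R).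

Lemma bigO_powR_le f u v : u <= v ->
  bigO_at_infty f (fun x => x `^ u) -> bigO_at_infty f (fun x => x `^ v).
Proof.
move=> uv /eqO_exP [k k0 fk]; apply/eqO_exP; exists k => //.
near=> x.
have x1 : 1 <= x by near: x; exact: nbhs_pinfty_ge.
apply: le_trans (_ : _ <= k * `|x `^ u|) _; first by near: x.
by rewrite ler_pM2l // !ger0_norm ?powR_ge0 // ler_powR.
Unshelve. all: by end_near. Qed.

Lemma bigO_powR_littleo f u v : u < v ->
  bigO_at_infty f (fun x => x `^ u) -> f =o_ (pinfty_nbhs R) (fun x => x `^ v : R^o).
Proof.
move=> uv /eqO_exP [k k0 fk]; apply/eqoP => eps eps0.
near=> x.
have x1 : 1 <= x by near: x; exact: nbhs_pinfty_ge.
have x0 : 0 < x by lra.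
(* Beyond this threshold, k <= eps * x ^ (v - u). *)
have keps : (k / eps) `^ (v - u)^-1 <= x by near: x; exact: nbhs_pinfty_ge.
apply: le_trans (_ : _ <= k * `|x `^ u|) _; first by near: x.
rewrite !ger0_norm ?powR_ge0 //.
have -> : v = (v - u) + u by ring.
rewrite powRD; last by apply/implyP => _; rewrite gt_eqF.
rewrite mulrA ler_wpM2r ?powR_ge0 // mulrC -ler_pdivrMr //.
have : ((k / eps) `^ (v - u)^-1) `^ (v - u) <= x `^ (v - u).
  by rewrite ge0_ler_powR ?nnegrE ?powR_ge0 ?subr_ge0 ?(ltW uv) // ltW.
by rewrite -powRrM mulVf ?subr_eq0 ?gt_eqF // powRr1 // divr_ge0 ?ltW.
Unshelve. all: by end_near. Qed.

Lemma littleo_powR_le f u v : u <= v ->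
  f =o_ (pinfty_nbhs R) (fun x => x `^ u : R^o) -> f =o_ (pinfty_nbhs R) (fun x => x `^ v : R^o).
Proof.
move=> uv /eqoP fo; apply/eqoP => eps eps0.
near=> x.
have x1 : 1 <= x by near: x; exact: nbhs_pinfty_ge.
apply: le_trans (_ : _ <= eps * `|x `^ u|) _.
  by near: x; apply: fo.
by rewrite ler_pM2l // !ger0_norm ?powR_ge0 // ler_powR.
Unshelve. all: by end_near. Qed.

(** A function that is [O(x ^ beta)] but not [o(x ^ beta)] is [o(x ^ v)] for
    [beta < v], and not [O(x ^ v)] for [v < beta]. *)
Lemma exact_exponent_unique (m : nat) (beta : R) : (0 < m)%N ->
  (forall (a : 'I_m) (j : 'I_2),
    bigO_at_infty (count_error a j) (fun x : R => x `^ beta) /\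
    not_littleo_at_infty (count_error a j) (fun x : R => x `^ beta)) ->
  forall alpha, exact_exponent m alpha <-> alpha = beta.
Proof.
move=> m0 sharp alpha; split=> [ex|-> eps eps0 a j]; last first.
  have [big no] := sharp a j; split; first by apply: bigO_powR_le big; lra.
  by move=> small; apply: no; apply: littleo_powR_le small; lra.
have [big no] := sharp (Ordinal m0) ord0.
case: (ltgtP alpha beta) => [ab|ba|]; last by [].
  have eps0 : 0 < (beta - alpha) / 2 by lra.
  case: (ex _ eps0 (Ordinal m0) ord0) => big' _; case: no.
  by apply: bigO_powR_littleo big'; lra.
have eps0 : 0 < (alpha - beta) / 2 by lra.
case: (ex _ eps0 (Ordinal m0) ord0) => _; case.
by apply: bigO_powR_littleo big; lra.
Qed.

End Asymptotics.

(** * The growth of the error term *)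

Section Sharp.
Variables (R : realType) (p : nat).
Hypotheses (p_prime : prime p) (p_odd : odd p) (two_prim : two_is_primitive_root p).

Let alpha : R := ln p%:R / ((p%:R - 1) * ln 2).

Lemma exponent_ge0 : 0 <= alpha.
Proof.
have p1 : 1 < p%:R :> R by rewrite ltr1n prime_gt1.
by rewrite divr_ge0 ?mulr_ge0 ?ln_ge0 //; lra.
Qed.

Lemma block_length_powR : (2 ^ p.-1)%:R `^ alpha = p%:R :> R.
Proof.
have p1 : 1 < p%:R :> R by rewrite ltr1n prime_gt1.
have l2 : 0 < ln 2 :> R by rewrite ln_gt0 // ltr1n.
rewrite natrX /powR -powR_mulrn // ln_powR powR_eq0 pnatr_eq0 /=.
have -> : (p.-1)%:R = p%:R - 1 :> R by rewrite -subn1 natrB // prime_gt0.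
rewrite /alpha divfK ?lnK ?posrE //; first by lra.
by rewrite gt_eqF // mulr_gt0 //; lra.
Qed.

(** The additive constant absorbs the bounded error of [residue_sum_block_rem]:
    with [K = 2 ^ (p - 1) + 1], the inequality [u' <= p * u + K] gives
    [u' + K <= p * (u + K)] because [2 <= p]. The factor [2 * 2 ^ (p - 1) + 1] is
    [2 ^ (p - 1) + K], a bound for [N < 2 ^ (p - 1)]. *)
Lemma residue_sum_upper (a N : nat) : (0 < N)%N ->
  `|residue_sum p a N|%:~R + (2 ^ p.-1).+1%:R
     <= (2 * 2 ^ p.-1).+1%:R * N%:R `^ alpha :> R.
Proof.
set b := (2 ^ p.-1)%N.
have b1 : (1 < b)%N.
  by rewrite -(exp1n p.-1) ltn_exp2r //; case: p p_prime => [|[]].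
have p2 := prime_gt1 p_prime.
elim/ltn_ind: N => N IHN N0.
have r_lt : (N %% b < b)%N by rewrite ltn_mod; lia.
have [Nb|bN] := ltnP N b.
  apply: le_trans (_ : (2 * b).+1%:R <= _).
    rewrite (_ : (2 * b).+1 = b + b.+1)%N ?natrD ?lerD2r; last by lia.
    rewrite -(rmorph_nat intr) ler_int.
    by apply: le_trans (normr_residue_sum _ _ _) _; rewrite ler_nat ltnW.
  have one : 1 `^ alpha = 1 by rewrite powR1.
  rewrite ler_peMr // -[leLHS]one.
  by rewrite ge0_ler_powR ?nnegrE ?exponent_ge0 // ler1n.
have Nq : (0 < N %/ b)%N by rewrite divn_gt0 //; lia.
have qN : (N %/ b < N)%N by rewrite ltn_Pdiv.
have := IHN _ qN Nq; set q := (N %/ b)%N => IHq.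
apply: le_trans (_ : p%:R * ((2 * b).+1%:R * q%:R `^ alpha) <= _); last first.
  rewrite -block_length_powR mulrCA ler_wpM2l // -powRM //.
  rewrite ge0_ler_powR ?nnegrE ?exponent_ge0 ?mulr_ge0 //.
  by rewrite -natrM ler_nat mulnC leq_divM.
apply: le_trans (ler_wpM2l (ler0n R p) IHq).
have := residue_sum_block_rem p_prime p_odd two_prim a q r_lt.
rewrite mulnC -divn_eq -(ler_int R) rmorphD rmorphM /= !rmorph_nat.
rewrite -/b => h.
have p2R : 2 <= p%:R :> R by rewrite ler_nat.
have := ler_wpM2r (ler0n R b.+1) p2R.
lra.
Qed.

Lemma count_error_bigO (a : 'I_p) (j : 'I_2) :
  bigO_at_infty (count_error a j) (fun x : R => x `^ alpha).
Proof.
set C : R := (2 * 2 ^ p.-1).+1%:R.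
have C0 : 0 < C by rewrite ltr0n.
apply/eqO_exP; exists (1 + C * 2 `^ alpha).
  by rewrite ltr_pwDl // mulr_ge0 ?powR_ge0 // ltW.
near=> x.
have x1 : 1 <= x by near: x; exact: nbhs_pinfty_ge.
have /andP[c1 c2] := ceil_itv x.
have cx : (`|Num.ceil x|%N)%:R = (Num.ceil x)%:~R :> R.
  by rewrite natr_absz ger0_norm // ceil_ge0; lra.
have xN : `|Num.ceil x|%N%:R - 1 < x <= `|Num.ceil x|%N%:R.
  by rewrite cx c2 andbT -(rmorph1 intr) -rmorphB.
have N0 : (0 < `|Num.ceil x|)%N by rewrite -(ltr_nat R) cx; lra.
have := count_error_residue_sum a j xN.
have := residue_sum_upper a N0.
move: (`|Num.ceil x|%N) xN N0 => N /andP[N1 xN] N0 up err.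
have Nx : N%:R `^ alpha <= 2 `^ alpha * x `^ alpha.
  rewrite -powRM //.
  by rewrite ge0_ler_powR ?nnegrE ?exponent_ge0 ?mulr_ge0 //; lra.
have xa : 1 <= x `^ alpha by rewrite -(powRr0 x) ler_powR ?exponent_ge0.
rewrite (ger0_norm (powR_ge0 _ _)) mulrDl mul1r.
rewrite -[count_error a j x](subrK ((-1) ^+ j * (residue_sum p a N)%:~R / 2)).
apply: le_trans (ler_normD _ _) _; apply: lerD; first exact: le_trans err _.
rewrite normrM normrM normrX normrN1 expr1n mul1r -mulrA.
have b0 : 0 <= (2 ^ p.-1).+1%:R :> R by [].
have := ler_wpM2l (ltW C0) Nx.
rewrite -/C -(intr_norm) in up *.
rewrite (ger0_norm (_ : 0 <= 2^-1)) //.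
have : 0 <= `|residue_sum p a N|%:~R :> R by rewrite ler0z.
lra.
Unshelve. all: by end_near. Qed.

(** Along [x = 2 ^ ((p - 1) * (q + 1))] the error is at least [p ^ q / 2 - 1],
    while [x ^ alpha = p ^ (q + 1)]. *)
Lemma count_error_not_littleo (a : 'I_p) (j : 'I_2) :
  not_littleo_at_infty (count_error a j) (fun x : R => x `^ alpha).
Proof.
have p2 := prime_gt1 p_prime.
have p0 : 0 < p%:R :> R by rewrite ltr0n; lia.
(* With this constant, smallness at x = 2 ^ ((p - 1) * (q + 1)) would give
   p ^ q / 2 - 1 <= p ^ q / 4, which fails as soon as p ^ q > 4. *)
move=> /eqoP /(_ (4 * p%:R)^-1); rewrite invr_gt0 mulr_gt0 // => /(_ isT).
move=> [M [_ oM]].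
pose b := (2 ^ p.-1)%N.
have b1 : (1 < b)%N.
  by rewrite -(exp1n p.-1) ltn_exp2r //; case: p p_prime => [|[]].
(* Large enough for b ^ (q + 1) to exceed M and for p ^ q to be at least 5. *)
pose q := (`|Num.ceil M|%N + 5)%N.
have Mq : M < (b ^ q.+1)%:R.
  apply: le_lt_trans (ceil_ge M) _.
  apply: le_lt_trans (_ : q.+1%:R < _); last by rewrite ltr_nat ltn_expl.
  by apply: le_trans (ler_norm _) _; rewrite -intr_norm -natr_absz ler_nat /q -addnS leq_addr.
have := oM _ Mq.
have xN : (b ^ q.+1)%:R - 1 < ((b ^ q.+1)%:R : R) <= (b ^ q.+1)%:R.
  by rewrite lexx andbT; lra.
have := count_error_residue_sum a j xN.
have := residue_sum_expn_ge p_prime p_odd two_prim a q.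
rewrite -(ler_int R) rmorphXn /= rmorph_nat intr_norm -/b => low err.
rewrite (ger0_norm (powR_ge0 _ _)).
have -> : (b ^ q.+1)%:R `^ alpha = p%:R * p%:R ^+ q :> R.
  rewrite -exprS natrX -powR_mulrn // -powRrM mulrC powRrM block_length_powR.
  by rewrite powR_mulrn.
have -> : (4 * p%:R)^-1 * (p%:R * p%:R ^+ q) = p%:R ^+ q / 4 :> R.
  by field; rewrite gt_eqF.
move=> up.
have pq : 5 <= p%:R ^+ q :> R.
  rewrite -natrX ler_nat; apply: leq_trans (ltnW (ltn_expl q p2)); rewrite /q; lia.
set D : R := (residue_sum p a _)%:~R in low err.
have : `|(-1) ^+ j * D / 2| = `|D| / 2.
  by rewrite normrM normrM normrX normrN1 expr1n mul1r (ger0_norm (_ : 0 <= 2^-1)).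
have := ler_normB (count_error a j (b ^ q.+1)%:R : R)
  (count_error a j (b ^ q.+1)%:R - (-1) ^+ j * D / 2).
rewrite subKr.
lra.
Qed.

Lemma exponent_le : alpha <= ln 3 / ln 4.
Proof.
have p1 : 1 < p%:R :> R by rewrite ltr1n prime_gt1.
have p3 : (3 <= p)%N by case: p p_prime p_odd => [|[|[]]].
have l2 : 0 < ln 2 :> R by rewrite ln_gt0 // ltr1n.
have -> : ln 4 = 2 * ln 2 :> R.
  rewrite (_ : 4 = 2 * 2) ?lnM ?posrE //; first by ring.
  by rewrite -natrM.
have pexp : (p ^ 2 <= 3 ^ p.-1)%N.
  rewrite -(subnK p3) addn3 /=; elim: (p - 3)%N => // k IHk.
  rewrite [(3 ^ _)%N]expnS; apply: leq_trans (_ : 3 * k.+3 ^ 2 <= _)%N; first by nia.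
  by rewrite leq_mul2l.
have : 2 * ln p%:R <= (p%:R - 1) * ln 3 :> R.
  have -> : (p%:R - 1) = (p.-1)%:R :> R by rewrite -subn1 natrB // prime_gt0.
  rewrite -[2 in X in X <= _]/(2%:R) -!ln_powR !powR_mulrn //.
  by rewrite ler_ln ?posrE ?exprn_gt0 -?natrX ?ler_nat //; lra.
move=> h; rewrite ler_pdivrMr ?mulr_gt0 //; last by lra.
have -> : ln 3 / (2 * ln 2) * ((p%:R - 1) * ln 2) = (p%:R - 1) * ln 3 / 2 :> R.
  by field; rewrite gt_eqF.
by lra.
Qed.

End Sharp.

(** * The exact exponent *)

Theorem theorem2 (R : realType) (p : nat) (p_prime : prime p) (p_odd : odd p)
    (two_prim : two_is_primitive_root p) :
  (forall (a : 'I_p) (j : 'I_2),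
     bigO_at_infty (count_error a j)
       (fun x : R => x `^ (ln (3 : R) / ln (4 : R)))) /\
  (forall alpha : R,
     exact_exponent p alpha <-> alpha = ln (p%:R : R) / ((p%:R - 1) * ln 2)).
Proof.
split=> [a j|].
  apply: bigO_powR_le (count_error_bigO R p_prime p_odd two_prim a j).
  exact: exponent_le.
apply: exact_exponent_unique => [|a j]; first exact: prime_gt0.
split; [exact: count_error_bigO | exact: count_error_not_littleo].
Qed.
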